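(* Let $(R,\mathfrak{m})$ be a commutative noetherian local ring, and let $M$ be a separated $R$-module that is pure in its $\mathfrak{m}$-adic completion $\hat M$. Then: (a) $M$ is pure-essential in $\hat M$. (b) $M$ is totally reduced, i.e. for every finitely generated $R$-module $X$, the module $X\otimes_RM$ is reduced. (c) $\operatorname{Ass}(\hat M)\subset\operatorname{Koatt}(M)$.
   Context: An $R$-module $M$ is separated if $\bigcap_{n\ge1}\mathfrak{m}^nM=0$; then $M$ is regarded as a submodule of $\hat M=\varprojlim M/\mathfrak{m}^nM$ via the canonical map. A module $A$ is radical-full if $\mathfrak{m}A=A$; $P(A)$ denotes the largest radical-full submodule of $A$, and $A$ is reduced if $P(A)=0$. A pure submodule $A\subset B$ is pure-essential in $B$ if every submodule $X\subset B$ with $X\cap A=0$ and $(X\oplus A)/X$ pure in $B/X$ is zero. $\operatorname{Ass}(\hat M)$ is the set of primes of $R$ associated to the $R$-module $\hat M$; $\operatorname{Koatt}(M)$ is the set of primes $\mathfrak{p}$ of $R$ such that $\mathfrak{p}=\operatorname{Ann}_R(U)$ for some submodule $U\subset M$. *)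

(* Defs.v *)
From HB Require Import structures.
From mathcomp Require Import all_boot all_algebra.
From mathcomp Require Import boolp classical_sets.
From mathcomp.multinomials Require Import freeg.

Set Implicit Arguments.
Unset Strict Implicit.
Unset Printing Implicit Defensive.

Import GRing.Theory.

Local Open Scope classical_set_scope.
Local Open Scope ring_scope.
Local Open Scope quotient_scope.

(* Submodules are the library's [submodClosed V]: boolean predicates, which
   under classical logic are arbitrary submodules. An ideal, possibly improper,
   is a [submodClosed R^o]; [idealr R] and [prime_idealr R] are the proper,
   resp. prime, ideals. *)

Section Submodules.
Variables (R : nzRingType) (V : lmodType R).
Implicit Types (A : set V) (S T : submodClosed V).

Definition fullm : {pred V} := predT.

Lemma fullm_closed : submod_closed fullm. Proof. by []. Qed.

HB.instance Definition _ := GRing.isSubmodClosed.Build R V fullm fullm_closed.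

Definition lspan A : {pred V} :=
  fun v => `[< forall S, A `<=` [set` S] -> v \in S >].

Lemma lspan_closed A : submod_closed (lspan A).
Proof.
split=> [|a u v /asboolP Au /asboolP Av]; apply/asboolP=> S AS.
  exact: rpred0.
by rewrite rpredD ?rpredZ ?Au ?Av.
Qed.

HB.instance Definition _ A :=
  GRing.isSubmodClosed.Build R V (lspan A) (lspan_closed A).

Lemma mem_lspan A v : A v -> v \in lspan A.
Proof. by move=> Av; apply/asboolP=> S; apply. Qed.

Lemma lspan_min A S : A `<=` [set` S] -> {subset lspan A <= S}.
Proof. by move=> AS v /asboolP; apply. Qed.

Definition finitely_generated : Prop :=
  exists s : seq V, forall v, v \in lspan [set` s].

Definition addm S T : {pred V} := lspan ([set` S] `|` [set` T]).

HB.instance Definition _ S T := GRing.SubmodClosed.on (addm S T).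

(* The submodule I S generated by the products a *: v. *)
Definition mulmod (I : {pred R}) (S : {pred V}) : {pred V} :=
  lspan [set w | exists a v, [/\ a \in I, v \in S & w = a *: v]].

HB.instance Definition _ I S := GRing.SubmodClosed.on (mulmod I S).

(* [submodClosed] does not record closure under opposite, which
   [Quotient.quot] requires: [smem S] is S with that instance added. *)
Definition smem S : {pred V} := fun v => v \in S.

Lemma smem_closed S : submod_closed (smem S).
Proof. exact: submodClosedP. Qed.

HB.instance Definition _ S :=
  GRing.isSubmodClosed.Build R V (smem S) (smem_closed S).

Definition subm S : Type := {v : V | v \in S}.

HB.instance Definition _ S := SubChoice.on (subm S).
HB.instance Definition _ S := [SubChoice_isSubLmodule of subm S by <:].

End Submodules.

Arguments fullm {R V}.
Arguments lspan {R V} A.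
Arguments finitely_generated {R} V.

Section Image.
Variables (R : nzRingType) (V W : lmodType R) (f : {linear V -> W}).

Definition imagem (S : submodClosed V) : {pred W} :=
  fun w => `[< exists2 v, v \in S & w = f v >].

Lemma imagem_closed S : submod_closed (imagem S).
Proof.
split=> [|a u v /asboolP[x Sx ->] /asboolP[y Sy ->]]; apply/asboolP.
  by exists 0; rewrite ?rpred0 ?linear0.
by exists (a *: x + y); rewrite ?rpredD ?rpredZ ?linearP.
Qed.

HB.instance Definition _ S :=
  GRing.isSubmodClosed.Build R W (imagem S) (imagem_closed S).

End Image.

Section QuotientModule.
Variables (R : nzRingType) (V : lmodType R) (S : submodClosed V).

Definition quotm : Type := Quotient.quot (smem S).

HB.instance Definition _ := GRing.Zmodule.on quotm.

Definition to_quotm (v : V) : quotm := \pi_(Quotient.quot (smem S)) v.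

Definition quotm_repr (q : quotm) : V := repr (q : Quotient.quot (smem S)).

Lemma quotm_reprK : cancel quotm_repr to_quotm.
Proof. exact: reprK. Qed.

Lemma to_quotm_eq u v : to_quotm u = to_quotm v <-> u - v \in S.
Proof.
rewrite -[u - v \in S]/(u - v \in smem S) Quotient.idealrBE.
by split=> /eqP.
Qed.

Lemma to_quotm_is_zmod_morphism : zmod_morphism to_quotm.
Proof. exact: raddfB (\pi_(Quotient.quot (smem S))). Qed.

Definition quotm_scale (a : R) (q : quotm) := to_quotm (a *: quotm_repr q).

Lemma quotm_scaleE a v : quotm_scale a (to_quotm v) = to_quotm (a *: v).
Proof.
apply/to_quotm_eq; rewrite -scalerBr rpredZ //.
by apply/to_quotm_eq; rewrite quotm_reprK.
Qed.

HB.instance Definition _ :=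
  GRing.isZmodMorphism.Build V quotm to_quotm to_quotm_is_zmod_morphism.

Lemma quotm_scaleA a b q :
  quotm_scale a (quotm_scale b q) = quotm_scale (a * b) q.
Proof. by rewrite -(quotm_reprK q) !quotm_scaleE scalerA. Qed.

Lemma quotm_scale1 : left_id 1 quotm_scale.
Proof. by move=> q; rewrite -(quotm_reprK q) quotm_scaleE scale1r. Qed.

Lemma quotm_scaleDr : right_distributive quotm_scale +%R.
Proof.
move=> a p q; rewrite -(quotm_reprK p) -(quotm_reprK q) -raddfD.
by rewrite !quotm_scaleE scalerDr raddfD.
Qed.

Lemma quotm_scaleDl q : {morph quotm_scale^~ q : a b / a + b}.
Proof.
by move=> a b; rewrite -(quotm_reprK q) !quotm_scaleE scalerDl raddfD.
Qed.

HB.instance Definition _ := GRing.Zmodule_isLmodule.Build R quotm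
  quotm_scaleA quotm_scale1 quotm_scaleDr quotm_scaleDl.

Lemma to_quotm_is_scalable : scalable to_quotm.
Proof. by move=> a v; rewrite -quotm_scaleE. Qed.

HB.instance Definition _ :=
  GRing.isScalable.Build R V quotm *:%R to_quotm to_quotm_is_scalable.

End QuotientModule.

Section QuotientMap.
Variables (R : nzRingType) (V : lmodType R) (S T : submodClosed V).

(* The projection V / S -> V / T, meaningful when S is contained in T. *)
Definition quotm_proj (q : quotm S) : quotm T := to_quotm T (quotm_repr q).

Lemma quotm_projE : {subset S <= T} ->
  forall v, quotm_proj (to_quotm S v) = to_quotm T v.
Proof.
by move=> ST v; apply/to_quotm_eq/ST/to_quotm_eq; rewrite quotm_reprK.
Qed.

Lemma quotm_proj_linear : {subset S <= T} -> linear quotm_proj.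
Proof.
move=> ST a p q; rewrite -(quotm_reprK p) -(quotm_reprK q) -linearP.
by rewrite !quotm_projE // linearP.
Qed.

End QuotientMap.

Section Tensor.
Variables (R : comNzRingType) (X Y : lmodType R).

Local Notation free := {freeg (X * Y)%type / R}.

Definition tensor_gen (x : X) (y : Y) : free := Freeg [:: (1, (x, y))].

Definition tensor_rel : set free :=
  [set z | (exists x x' y,
              z = tensor_gen (x + x') y - tensor_gen x y - tensor_gen x' y)
        \/ (exists x y y',
              z = tensor_gen x (y + y') - tensor_gen x y - tensor_gen x y')
        \/ (exists a x y, z = tensor_gen (a *: x) y - a *: tensor_gen x y)
        \/ (exists a x y, z = tensor_gen x (a *: y) - a *: tensor_gen x y)].

Definition tensor : Type := quotm (lspan tensor_rel).

HB.instance Definition _ := GRing.Lmodule.on tensor.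

Definition tens (x : X) (y : Y) : tensor :=
  to_quotm (lspan tensor_rel) (tensor_gen x y).

Lemma tens_linearl y : linear (tens^~ y).
Proof.
move=> a x x'; rewrite /tens -linearP; apply/to_quotm_eq.
set u := tensor_gen _ _; set v := tensor_gen x y; set w := tensor_gen x' y.
pose t := tensor_gen (a *: x) y.
have -> : u - (a *: v + w) = (u - t - w) + (t - a *: v).
  by rewrite [u - t - w]addrAC [RHS]addrA subrK opprD addrA addrAC.
apply: rpredD; apply: mem_lspan.
  by left; exists (a *: x), x', y.
by right; right; left; exists a, x, y.
Qed.

Lemma tens_linearr x : linear (tens x).
Proof.
move=> a y y'; rewrite /tens -linearP; apply/to_quotm_eq.
set u := tensor_gen _ _; set v := tensor_gen x y; set w := tensor_gen x y'.
pose t := tensor_gen x (a *: y).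
have -> : u - (a *: v + w) = (u - t - w) + (t - a *: v).
  by rewrite [u - t - w]addrAC [RHS]addrA subrK opprD addrA addrAC.
apply: rpredD; apply: mem_lspan.
  by right; left; exists x, (a *: y), y'.
by right; right; right; exists a, x, y.
Qed.

End Tensor.

Arguments tensor {R} X Y.

Section TensorLift.
Variables (R : comNzRingType) (X Y Z : lmodType R) (h : X -> Y -> Z).

(* The map induced by h, meaningful when h is bilinear. *)
Definition tensor_lift (t : tensor X Y) : Z :=
  fglift (fun p : X * Y => h p.1 p.2) (quotm_repr t).

Local Notation lift := (fglift (fun p : X * Y => h p.1 p.2)).

Lemma lift_linear : linear lift.
Proof.
pose L : {additive {freeg (X * Y)%type / R} -> Z} :=
  HB.pack lift (GRing.isZmodMorphism.Build _ _ lift (lift_is_additive _)).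
have liftD : {morph lift : u v / u + v} by exact: (raddfD L).
have liftZ a u : lift (a *: u) = a *: lift u.
  have -> : lift u = \sum_(k <- dom u) coeff k u *: h k.1 k.2.
    rewrite -[in LHS](freeg_sumE u) -[LHS]/(L _) raddf_sum.
    by apply: eq_bigr => k _; rewrite /= liftU.
  rewrite [a *: u]/(fgscale a u) /fgscale -[LHS]/(L _) raddf_sum scaler_sumr.
  by apply: eq_bigr => k _; rewrite /= liftU scalerA.
by move=> a u v; rewrite liftD liftZ.
Qed.

Hypothesis hl : forall y, linear (h^~ y).
Hypothesis hr : forall x, linear (h x).

Lemma lift_rel u : u \in lspan (@tensor_rel R X Y) -> lift u = 0.
Proof.
pose L : {linear {freeg (X * Y)%type / R} -> Z} :=
  HB.pack lift (GRing.isLinear.Build _ _ _ _ lift lift_linear).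
have liftE x y : L (tensor_gen x y) = h x y by rewrite /= liftU scale1r.
pose ker := fun v => L v == 0.
have ker_closed : submod_closed ker.
  split=> [|a v w /eqP v0 /eqP w0]; first by rewrite unfold_in linear0.
  by rewrite unfold_in linearP v0 w0 scaler0 addr0.
pose K : submodClosed _ :=
  HB.pack ker (GRing.isSubmodClosed.Build _ _ ker ker_closed).
have hDl y x x' : h (x + x') y = h x y + h x' y.
  by have := hl y 1 x x'; rewrite !scale1r.
have hDr x y y' : h x (y + y') = h x y + h x y'.
  by have := hr x 1 y y'; rewrite !scale1r.
have h0l y : h 0 y = 0.
  by apply: (addrI (h 0 y)); rewrite -hDl !addr0.
have h0r x : h x 0 = 0.
  by apply: (addrI (h x 0)); rewrite -hDr !addr0.
have hZl y a x : h (a *: x) y = a *: h x y.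
  by have := hl y a x 0; rewrite !addr0 h0l addr0.
have hZr x a y : h x (a *: y) = a *: h x y.
  by have := hr x a y 0; rewrite !addr0 h0r addr0.
move=> /(@lspan_min _ _ _ K) uK; apply/eqP/uK => v /= rel_v.
rewrite unfold_in; apply/eqP; case: rel_v => [|[|[|]]].
- by move=> [x [x' [y ->]]]; rewrite -[LHS]/(L _) !linearB !liftE hDl addrAC addrK subrr.
- by move=> [x [y [y' ->]]]; rewrite -[LHS]/(L _) !linearB !liftE hDr addrAC addrK subrr.
- by move=> [a [x [y ->]]]; rewrite -[LHS]/(L _) linearB linearZ !liftE hZl subrr.
- by move=> [a [x [y ->]]]; rewrite -[LHS]/(L _) linearB linearZ !liftE hZr subrr.
Qed.

Lemma tensor_lift_pi u : tensor_lift (to_quotm _ u) = lift u.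
Proof.
rewrite /tensor_lift; set v := quotm_repr _.
have : v - u \in lspan (@tensor_rel R X Y).
  by apply/to_quotm_eq; rewrite quotm_reprK.
move/lift_rel; rewrite -scaleN1r addrC lift_linear scaleN1r addrC.
by move/eqP; rewrite subr_eq0 => /eqP.
Qed.

Lemma tensor_liftE x y : tensor_lift (tens x y) = h x y.
Proof. by rewrite tensor_lift_pi liftU scale1r. Qed.

Lemma tensor_lift_linear : linear tensor_lift.
Proof.
move=> a s t; rewrite -(quotm_reprK s) -(quotm_reprK t) -linearP.
by rewrite !tensor_lift_pi lift_linear.
Qed.

End TensorLift.

Section TensorMap.
Variables (R : comNzRingType) (X X' Y Y' : lmodType R).
Variables (f : {linear X -> X'}) (g : {linear Y -> Y'}).

Definition tensor_map : tensor X Y -> tensor X' Y' :=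
  tensor_lift (fun x y => tens (f x) (g y)).

Lemma tensor_mapE x y : tensor_map (tens x y) = tens (f x) (g y).
Proof.
by apply: tensor_liftE => [{}y|{}x] a u v; rewrite linearP ?tens_linearl
  ?tens_linearr.
Qed.

Lemma tensor_map_linear : linear tensor_map.
Proof.
by apply: tensor_lift_linear => [y|x] a u v; rewrite linearP ?tens_linearl
  ?tens_linearr.
Qed.

HB.instance Definition _ :=
  GRing.isLinear.Build R (tensor X Y) (tensor X' Y') *:%R tensor_map
    tensor_map_linear.

End TensorMap.

Definition pure (R : comNzRingType) (B : lmodType R) (A : submodClosed B) :
    Prop :=
  forall N : lmodType R,
    injective (tensor_map (idfun : {linear N -> N})
                          (\val : {linear subm A -> B})).

(* The image of X + A in B / X is (X + A) / X; the first hypothesis on X makes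
   the sum direct. *)
Definition pure_essential (R : comNzRingType) (B : lmodType R)
    (A : submodClosed B) : Prop :=
  pure A /\
  forall X : submodClosed B,
    (forall x, x \in X -> x \in A -> x = 0) ->
    pure (imagem (to_quotm X) (addm X A)) ->
    forall x, x \in X -> x = 0.

Section Ring.
Variable R : comNzRingType.

Definition noetherian : Prop :=
  forall I : submodClosed R^o, exists s : seq R^o, I =i lspan [set` s].

Definition maximal_ideal (I : idealr R) : Prop :=
  forall J : idealr R, {subset I <= J} -> J =i I.

Definition local_ring (m : idealr R) : Prop :=
  maximal_ideal m /\ forall J : idealr R, maximal_ideal J -> J =i m.

Fixpoint idealX (I : idealr R) (n : nat) : submodClosed R^o :=
  if n is n'.+1 then mulmod (R := R) I (idealX I n') else fullm.

Definition ann (M : lmodType R) (A : set M) : set R :=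
  [set a | forall v, A v -> a *: v = 0].

Definition Ass (M : lmodType R) : set (prime_idealr R) :=
  [set p | exists x : M, [set` p] = ann [set x]].

Definition Koatt (M : lmodType R) : set (prime_idealr R) :=
  [set p | exists U : submodClosed M, [set` p] = ann [set` U]].

End Ring.

Section Adic.
Variables (R : comNzRingType) (m : idealr R) (M : lmodType R).

Definition adicm (n : nat) : {pred M} :=
  mulmod (R := R) (idealX m n) fullm.

HB.instance Definition _ n := GRing.SubmodClosed.on (adicm n).

Lemma adicm_sub n : {subset adicm n.+1 <= adicm n}.
Proof.
have IX k : {subset idealX m k.+1 <= idealX m k}.
  elim: k => [|k IHk] //=; apply: lspan_min => _ [a [b [am bI ->]]].
  by apply: mem_lspan; exists a, b; rewrite IHk.
apply: lspan_min => _ [a [v [/IX aI _ ->]]].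
by apply: mem_lspan; exists a, v.
Qed.

Definition separated : Prop :=
  forall x : M, (forall n, (0 < n)%N -> x \in adicm n) -> x = 0.

Record completion : Type := Completion {
  cseq :> forall n, quotm (adicm n);
  cseq_compat : forall n, quotm_proj (adicm n) (cseq n.+1) = cseq n
}.

Lemma completionP (x y : completion) : (forall n, x n = y n) -> x = y.
Proof.
case: x y => [x hx] [y hy] /= xy.
have {}xy : x = y by apply: functional_extensionality_dep.
by subst y; congr Completion; exact: Prop_irrelevance.
Qed.

HB.instance Definition _ := gen_eqMixin completion.
HB.instance Definition _ := gen_choiceMixin completion.

Fact completion_compat (x y : completion) a n :
  quotm_proj (adicm n) (a *: x n.+1 + y n.+1) = a *: x n + y n.
Proof.
rewrite -(cseq_compat x n) -(cseq_compat y n).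
exact: (quotm_proj_linear (@adicm_sub n)).
Qed.

Fact completion0_compat n :
  quotm_proj (adicm n) (0 : quotm (adicm n.+1)) = 0.
Proof.
rewrite -[X in quotm_proj _ X](linear0 (to_quotm (adicm n.+1))).
by rewrite quotm_projE ?linear0 //; exact: adicm_sub.
Qed.

Definition completion0 := Completion completion0_compat.

Definition completion_lin a (x y : completion) :=
  Completion (completion_compat x y a).

Definition completion_add x y := completion_lin 1 x y.
Definition completion_opp x := completion_lin (-1) x completion0.
Definition completion_scale a x := completion_lin a x completion0.

Lemma completion_addE x y n : completion_add x y n = x n + y n.
Proof. by rewrite /= scale1r. Qed.

Lemma completion_oppE x n : completion_opp x n = - x n.
Proof. by rewrite /= addr0 scaleN1r. Qed.

Lemma completion_scaleE a x n : completion_scale a x n = a *: x n.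
Proof. by rewrite /= addr0. Qed.

Definition completionE :=
  (completion_addE, completion_oppE, completion_scaleE).

Lemma completion_addA : associative completion_add.
Proof. by move=> x y z; apply: completionP => n; rewrite !completionE addrA. Qed.

Lemma completion_addC : commutative completion_add.
Proof. by move=> x y; apply: completionP => n; rewrite !completionE addrC. Qed.

Lemma completion_add0 : left_id completion0 completion_add.
Proof. by move=> x; apply: completionP => n; rewrite completionE add0r. Qed.

Lemma completion_addN : left_inverse completion0 completion_opp completion_add.
Proof. by move=> x; apply: completionP => n; rewrite !completionE addNr. Qed.

HB.instance Definition _ := GRing.isZmodule.Build completion
  completion_addA completion_addC completion_add0 completion_addN.

Lemma completion_scaleA a b x :
  completion_scale a (completion_scale b x) = completion_scale (a * b) x.
Proof. by apply: completionP => n; rewrite !completionE scalerA. Qed.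

Lemma completion_scale1 : left_id 1 completion_scale.
Proof. by move=> x; apply: completionP => n; rewrite completionE scale1r. Qed.

Lemma completion_scaleDr : right_distributive completion_scale +%R.
Proof. by move=> a x y; apply: completionP => n; rewrite !completionE scalerDr. Qed.

Lemma completion_scaleDl x : {morph completion_scale^~ x : a b / a + b}.
Proof. by move=> a b; apply: completionP => n; rewrite !completionE scalerDl. Qed.

HB.instance Definition _ := GRing.Zmodule_isLmodule.Build R completion
  completion_scaleA completion_scale1 completion_scaleDr completion_scaleDl.

Fact to_completion_compat (v : M) n :
  quotm_proj (adicm n) (to_quotm (adicm n.+1) v) = to_quotm (adicm n) v.
Proof. by rewrite quotm_projE //; exact: adicm_sub. Qed.

Definition to_completion (v : M) : completion :=
  Completion (to_completion_compat v).

Lemma to_completion_linear : linear to_completion.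
Proof.
by move=> a u v; apply: completionP => n; rewrite !completionE /= linearP.
Qed.

HB.instance Definition _ :=
  GRing.isLinear.Build R M completion *:%R to_completion to_completion_linear.

Lemma to_completion_inj : separated -> injective to_completion.
Proof.
move=> sepM; apply: raddf_inj => v v0; apply: sepM => n _.
rewrite -[v]subr0; apply/to_quotm_eq; rewrite linear0.
by have := congr1 (fun x : completion => x n) v0.
Qed.

(* M regarded as a submodule of its completion. *)
Definition completion_base : {pred completion} := imagem to_completion fullm.

HB.instance Definition _ := GRing.SubmodClosed.on completion_base.

Definition radical_full (U : submodClosed M) : Prop :=
  mulmod (R := R) m U =i U.

(* P(M), as the sum of all the radical-full submodules. *)
Definition radical_part : {pred M} :=
  lspan [set x | exists2 U : submodClosed M, radical_full U & x \in U].

HB.instance Definition _ := GRing.SubmodClosed.on radical_part.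

Lemma radical_full_part : radical_full radical_part.
Proof.
move=> x; apply/idP/idP; last first.
  apply: lspan_min => {}x /= [U fU]; rewrite -fU.
  apply: lspan_min => _ /= [a [v [am vU ->]]]; apply: mem_lspan.
  by exists a, v; split=> //; apply: mem_lspan; exists U.
by apply: lspan_min => _ /= [a [v [_ vP ->]]]; rewrite rpredZ.
Qed.

Lemma radical_part_max (U : submodClosed M) :
  radical_full U -> {subset U <= radical_part}.
Proof. by move=> fU x xU; apply: mem_lspan; exists U. Qed.

Definition reduced_module : Prop := forall x, x \in radical_part -> x = 0.

End Adic.

Arguments adicm {R} m M n.
Arguments separated {R} m M.
Arguments completion_base {R} m M.
Arguments to_completion {R} m {M} v.
Arguments radical_part {R} m M.
Arguments reduced_module {R} m M.

Definition totally_reduced (R : comNzRingType) (m : idealr R) (M : lmodType R) :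
    Prop :=
  forall X : lmodType R, finitely_generated X -> reduced_module m (tensor X M).

(* Main.v *)
From HB Require Import structures.
Require Import Defs.
From mathcomp Require Import all_boot all_algebra.
From mathcomp Require Import boolp classical_sets.
From mathcomp.multinomials Require Import freeg.

Set Implicit Arguments.
Unset Strict Implicit.
Unset Printing Implicit Defensive.

Import GRing.Theory.

Local Open Scope classical_set_scope.
Local Open Scope ring_scope.

(** Write C for the completion of M. Two facts carry the proof.

    Purity is used through finite systems of linear equations
    ([pure_solve]): a system with coefficients in R and constants in a pure
    submodule A of B that is solvable in B is solvable in A. It follows from a
    description of the zero sums of tensors x_i (x) y_i, the x_i generating the
    left factor: the family (y_i) is a combination of families (c_i z), for
    relations c among the x_i ([tensor_eq0_relations]).

    Completeness gives, first, that M is dense in C for the m-adic topology of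
    C itself ([completion_dense]); this needs the powers of m to be finitely
    generated. Secondly, it gives a form of Nakayama's lemma
    ([complete_nakayama]): let f : C^J -> C^I be given by a matrix over R and
    let U be a part of C^I contained in m U + f(C^J); then U is contained in
    f(C^J). Unrolling the hypothesis writes u in U, for every n, as f of the
    n-th partial sum of a convergent series plus a term in m^n U.

    (a) Let X in C meet M in 0, with (X + M) / X pure in C / X. Given x in X
    and n, density gives v in M with x - v = sum_k c_k w_k and c_k in m^n.
    In C / X this expresses the class of v linearly in the classes of the
    w_k; by purity these can be replaced by classes of elements of M, and as X
    meets M in 0 this puts v in m^n C. So x lies in every m^n C.

    (b) A finitely generated module X is finitely presented, so X (x) M is
    the cokernel of some f : M^J -> M^I. The preimage U in M^I of a
    radical-full submodule satisfies U = m U + f(M^J). In C^I the form of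
    Nakayama's lemma above puts U in f(C^J), and purity puts it back in
    f(M^J): the submodule is zero.

    (c) If p = Ann(x) with x in C, let U be the submodule of M killed by p.
    By purity an approximation of x in M can be corrected to one in U, so x is
    a limit of elements of U. Hence whatever kills U kills x, and Ann(U) = p. *)

(** * Spans, products and noetherian modules *)

Section Spans.
Context {R : comNzRingType}.
Implicit Types V W : lmodType R.

Lemma lspan_ind V (A P : set V) :
    P 0 -> (forall a u v, P u -> P v -> P (a *: u + v)) -> A `<=` P ->
  forall v, v \in lspan A -> P v.
Proof.
move=> P0 PD AP v vA; pose p : {pred V} := fun v => `[< P v >].
have p_closed : submod_closed p.
  split=> [|a u w /asboolP Pu /asboolP Pw]; apply/asboolP => //.
  exact: PD.
pose S : submodClosed V :=
  HB.pack p (GRing.isSubmodClosed.Build _ _ p p_closed).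
apply/asboolP; apply: (@lspan_min _ _ A S) vA => u /AP Pu; exact/asboolP.
Qed.

Lemma rpredZD V (S : submodClosed V) a u v :
  u \in S -> v \in S -> a *: u + v \in S.
Proof. by move=> uS vS; rewrite rpredD ?rpredZ. Qed.

Lemma submB V (S : submodClosed V) u v : u \in S -> v \in S -> u - v \in S.
Proof. by move=> uS vS; rewrite -scaleN1r rpredD ?rpredZ. Qed.

Lemma lspan_rangeP V (J : finType) (g : J -> V) v :
  v \in lspan (range g) -> exists c : J -> R, v = \sum_j c j *: g j.
Proof.
move: v; apply: lspan_ind => [|a u v [c ->] [d ->]|_ [j _ <-]].
- by exists (fun=> 0); rewrite big1 // => j _; rewrite scale0r.
- exists (fun j => a * c j + d j); rewrite scaler_sumr -big_split /=.
  by apply: eq_bigr => j _; rewrite scalerDl scalerA.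
exists (fun k => (k == j)%:R); rewrite (bigD1 j) //= eqxx scale1r.
by rewrite big1 ?addr0 // => k /negPf ->; rewrite scale0r.
Qed.

Lemma lspan_seq_range V (s : seq V) :
  lspan [set` s] =i lspan (range (tnth (in_tuple s))).
Proof.
move=> v; apply/idP/idP; apply: lspan_min => {v} v /=.
  by move=> /(tnthP (in_tuple s))[i ->]; apply: mem_lspan; exists i.
by move=> [i _ <-]; apply: mem_lspan; exact: (mem_tnth i (in_tuple s)).
Qed.

Lemma mulmod_mem V (I : {pred R}) (S : {pred V}) a v :
  a \in I -> v \in S -> a *: v \in mulmod I S.
Proof. by move=> aI vS; apply: mem_lspan; exists a, v. Qed.

Lemma mulmod_sub {V} {I J : {pred R}} {S T : {pred V}} :
  {subset I <= J} -> {subset S <= T} -> {subset mulmod I S <= mulmod J T}.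
Proof.
move=> IJ ST; apply: lspan_min => _ [a [v [/IJ aJ /ST vT ->]]].
exact: mulmod_mem.
Qed.

Lemma mulmod_rangeP V (I : submodClosed R^o) (S : submodClosed V)
    (J : finType) (a : J -> R^o) w : I =i lspan (range a) ->
    w \in mulmod (R := R) I S ->
  exists2 u : J -> V, (forall j, u j \in S) & w = \sum_j a j *: u j.
Proof.
move=> Ia; move: w; apply: lspan_ind => [|b _ _ [u uS ->] [v vS ->]|].
- exists (fun=> 0) => [j|]; first exact: rpred0.
  by rewrite big1 // => j _; rewrite scaler0.
- exists (fun j => b *: u j + v j) => [j|]; first by rewrite rpredD ?rpredZ.
  rewrite scaler_sumr -big_split /=; apply: eq_bigr => j _.
  by rewrite scalerDr !scalerA mulrC.
move=> _ [b [v [/[!Ia]/lspan_rangeP[c ->] vS ->]]].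
exists (fun j => c j *: v) => [j|]; first by rewrite rpredZ.
rewrite scaler_suml; apply: eq_bigr => j _.
by rewrite !scalerA mulrC.
Qed.

(** Generators are indexed by an arbitrary finite type, so that those of an
    extension can be indexed by a disjoint sum. *)
Definition noetherian_module V : Prop := forall S : submodClosed V,
  exists (J : finType) (g : J -> V), S =i lspan (range g).

Lemma noetherian_regular : noetherian R -> noetherian_module R^o.
Proof.
move=> nR S; have [s Ss] := nR S.
by exists 'I_(size s), (tnth (in_tuple s)) => v; rewrite Ss lspan_seq_range.
Qed.

(** A submodule S of V is generated by lifts of generators of p(S) and by
    the images of generators of the preimage of S in V'. *)
Lemma noetherian_extension {V V' W} (i : {linear V' -> V})
    (p : {linear V -> W}) :
    (forall v, p v = 0 -> exists v', v = i v') ->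
  noetherian_module V' -> noetherian_module W -> noetherian_module V.
Proof.
move=> ker_p nV' nW S.
have [J [g Sg]] := nW (imagem p S).
have [K [h Sh]] := nV' (lspan [set v' | i v' \in S]).
have /choice[l lP] j : exists v, v \in S /\ g j = p v.
  have : g j \in imagem p S by rewrite Sg; apply: mem_lspan; exists j.
  by move=> /asboolP[v]; exists v.
have hS k : i (h k) \in S.
  have : h k \in lspan (range h) by apply: mem_lspan; exists k.
  rewrite -Sh; apply: (@lspan_ind _ _ [set v' | i v' \in S]) => //=.
    by rewrite linear0 rpred0.
  by move=> a u v uS vS; rewrite linearP rpredD ?rpredZ.
pose f (s : J + K) := match s with inl j => l j | inr k => i (h k) end.
have fS : {subset lspan (range f) <= S}.
  apply: (@lspan_min _ _ _ S) => _ [[j|k] _ <-] /=; last exact: hS.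
  by case: (lP j).
exists (J + K)%type, f => v; apply/idP/idP => [vS|/fS //].
have : p v \in imagem p (lspan (range f)).
  have : p v \in imagem p S by apply/asboolP; exists v.
  rewrite Sg; apply: lspan_min => _ [j _ <-]; apply/asboolP; exists (l j).
    by apply: mem_lspan; exists (inl j).
  by case: (lP j).
move=> /asboolP[u uf pvu].
have [|v' vu] := ker_p (v - u); first by rewrite linearB /= pvu subrr.
have : v' \in lspan (range h).
  by rewrite -Sh; apply: mem_lspan; rewrite /= -vu; exact: submB (fS _ uf).
move=> /(@lspan_ind _ _ [set v' | i v' \in lspan (range f)]) h_f.
rewrite -(subrK u v) rpredD // vu; apply: h_f => /= [|a x y xf yf|_ [k _ <-]].
- by rewrite linear0 rpred0.
- by rewrite linearP rpredD ?rpredZ.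
by apply: mem_lspan; exists (inr k).
Qed.

(** Induction on n, splitting off the first coordinate. *)
Lemma noetherian_power n : noetherian R -> noetherian_module {ffun 'I_n -> R^o}.
Proof.
move=> nR; elim: n => [|n IHn].
  move=> S; exists void, (fun=> 0) => v.
  by have -> : v = 0 by [apply/ffunP => -[]]; rewrite !rpred0.
pose i (c : {ffun 'I_n -> R^o}) : {ffun 'I_n.+1 -> R^o} :=
  [ffun k => if unlift ord0 k is Some j then c j else 0].
pose p (c : {ffun 'I_n.+1 -> R^o}) : R^o := c ord0.
have i_lin : linear i.
  move=> a u v; apply/ffunP => k; rewrite !ffunE.
  by case: unliftP => [j _|_]; rewrite ?ffunE // scaler0 addr0.
have p_lin : linear p by move=> a u v; rewrite /p !ffunE.
pose iL : {linear {ffun 'I_n -> R^o} -> {ffun 'I_n.+1 -> R^o}} :=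
  HB.pack i (GRing.isLinear.Build _ _ _ _ i i_lin).
pose pL : {linear {ffun 'I_n.+1 -> R^o} -> R^o} :=
  HB.pack p (GRing.isLinear.Build _ _ _ _ p p_lin).
apply: (noetherian_extension (i := iL) (p := pL) _ IHn (noetherian_regular nR)).
move=> v v0; exists [ffun j => v (fintype.lift ord0 j)]; apply/ffunP => k.
by rewrite [RHS]ffunE; case: unliftP => [j ->|-> //]; rewrite ffunE.
Qed.

(** Serves to pass, in both directions, between annihilation by an ideal and
    annihilation by finitely many generators of it. *)
Lemma lspan_annihilates V (A : set R^o) (v : V) :
    (forall a, A a -> (a : R) *: v = 0) ->
  forall a, a \in lspan A -> (a : R) *: v = 0.
Proof.
apply: (@lspan_ind _ _ [set a : R^o | (a : R) *: v = 0]) => /=.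
- by rewrite scale0r.
- by move=> a b c bv cv; rewrite scalerDl -scalerA bv cv scaler0 addr0.
Qed.

End Spans.

(** * Vanishing in tensor products, and purity *)

Section TensorPurity.
Context {R : comNzRingType}.

HB.instance Definition _ (X Y : lmodType R) (x : X) :=
  GRing.isLinear.Build R Y (tensor X Y) *:%R (@tens R X Y x) (tens_linearr x).

Lemma tensZl (X Y : lmodType R) a (x : X) (y : Y) :
  tens (a *: x) y = a *: tens x y.
Proof.
pose L : {linear X -> tensor X Y} :=
  HB.pack (fun x => tens x y) (GRing.isLinear.Build _ _ _ _ _ (tens_linearl y)).
by rewrite -[LHS]/(L _) linearZ.
Qed.

Lemma tens0l (X Y : lmodType R) (y : Y) : tens (0 : X) y = 0.
Proof. by rewrite -(scale0r (0 : X)) tensZl scale0r. Qed.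

Lemma tens_suml (X Y : lmodType R) (J : finType) (x : J -> X) (y : Y) :
  tens (\sum_j x j) y = \sum_j tens (x j) y.
Proof.
pose L : {linear X -> tensor X Y} :=
  HB.pack (fun x => tens x y) (GRing.isLinear.Build _ _ _ _ _ (tens_linearl y)).
by rewrite -[LHS]/(L _) linear_sum.
Qed.

Lemma tensor_ind (X Y : lmodType R) (P : set (tensor X Y)) :
    P 0 -> (forall a t u, P t -> P u -> P (a *: t + u)) ->
    (forall x y, P (tens x y)) ->
  forall t, P t.
Proof.
move=> P0 PD Pt t; rewrite -(quotm_reprK t) -[quotm_repr t]freeg_sumE.
rewrite linear_sum; elim/big_rec: _ => // -[x y] t' _ Pt'.
set c := coeff _ _.
have -> : << c *g (x, y) >> = c *: tensor_gen x y.
  by apply/eqP/freeg_eqP => k; rewrite coeffZ !coeffU mul1r.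
by rewrite linearZ; apply: PD => //; apply: Pt.
Qed.

Section Relations.
Variables (X : lmodType R) (I : finType) (x : I -> X).
Hypothesis x_gen : forall u, exists c : I -> R, u = \sum_i c i *: x i.

Lemma tensor_sum (Y : lmodType R) (t : tensor X Y) :
  exists y : I -> Y, t = \sum_i tens (x i) (y i).
Proof.
move: t; apply: tensor_ind => [|a _ _ [y ->] [z ->]|u y].
- by exists (fun=> 0); rewrite big1 // => i _; rewrite linear0.
- exists (fun i => a *: y i + z i); rewrite scaler_sumr -big_split /=.
  by apply: eq_bigr => i _; rewrite linearP.
have [c ->] := x_gen u; exists (fun i => c i *: y).
by rewrite tens_suml; apply: eq_bigr => i _; rewrite tensZl linearZ.
Qed.

(** Choosing coefficients c(u) of each u on the generators x makes
    (u, z) |-> (c(u)_i z)_i bilinear modulo the families built from relations.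
    The induced map on the tensor product sends the given sum to the class of
    y, which is therefore zero. *)
Lemma tensor_eq0_relations (Y : lmodType R) (y : {ffun I -> Y}) :
    \sum_i tens (x i) (y i) = 0 ->
  y \in lspan [set w | exists c z,
                 \sum_i c i *: x i = 0 /\ w = [ffun i => c i *: z]].
Proof.
set A := [set w | _]; have /choice[c cP] := x_gen.
pose h u z := to_quotm (lspan A) [ffun i => c u i *: z].
have relP (d : I -> R) z : \sum_i d i *: x i = 0 ->
    to_quotm (lspan A) [ffun i => d i *: z] = 0.
  move=> d0; rewrite -(linear0 (to_quotm (lspan A))).
  by apply/to_quotm_eq; rewrite subr0; apply: mem_lspan; exists d, z.
have hr u : linear (h u).
  move=> a z z'; rewrite /h -linearP; congr to_quotm.
  by apply/ffunP => i; rewrite !ffunE scalerDr !scalerA mulrC.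
have hl z : linear (h^~ z).
  move=> a u v; apply/eqP; rewrite -subr_eq0 /h -linearP -linearB.
  rewrite -(relP (fun i => c (a *: u + v) i - (a * c u i + c v i)) z).
    apply/eqP; congr to_quotm; apply/ffunP => i; rewrite !ffunE.
    by rewrite !scalerBl scalerDl scalerA.
  under eq_bigr do rewrite scalerBl scalerDl -scalerA.
  by rewrite sumrB big_split -scaler_sumr -!cP subrr.
pose L : {linear tensor X Y -> quotm (lspan A)} :=
  HB.pack (tensor_lift h)
    (GRing.isLinear.Build _ _ _ _ _ (tensor_lift_linear hl hr)).
move=> /(congr1 L); rewrite linear_sum linear0 /= => sum0.
have : to_quotm (lspan A) y = 0.
  have y_sum : y = \sum_i [ffun k => (k == i)%:R *: y i].
    apply/ffunP => k; rewrite sum_ffunE (bigD1 k) //= ffunE eqxx scale1r.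
    by rewrite big1 ?addr0 // => i /negPf ik; rewrite ffunE eq_sym ik scale0r.
  rewrite -sum0 [in LHS]y_sum linear_sum; apply: eq_bigr => i _.
  rewrite tensor_liftE //; apply/eqP; rewrite -subr_eq0 /h -linearB.
  rewrite -(relP (fun k => (k == i)%:R - c (x i) k) (y i)).
    by apply/eqP; congr to_quotm; apply/ffunP => k; rewrite !ffunE scalerBl.
  under eq_bigr do rewrite scalerBl.
  rewrite sumrB -cP (bigD1 i) //= eqxx scale1r big1 ?addr0 ?subrr //.
  by move=> k /negPf ->; rewrite scale0r.
rewrite -(linear0 (to_quotm (lspan A))) => /to_quotm_eq.
by rewrite subr0.
Qed.

Lemma tensor_eq0_fin (Y : lmodType R) (J : finType) (r : J -> {ffun I -> R^o})
    (y : {ffun I -> Y}) :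
    (forall c : {ffun I -> R^o}, \sum_i (c i : R) *: x i = 0 ->
       c \in lspan (range r)) ->
    \sum_i tens (x i) (y i) = 0 ->
  exists z : J -> Y, forall i, y i = \sum_j (r j i : R) *: z j.
Proof.
move=> r_gen /tensor_eq0_relations; move: y; apply: lspan_ind.
- exists (fun=> 0) => i; rewrite ffunE big1 // => j _; exact: scaler0.
- move=> a u v [z uz] [w vw]; exists (fun j => a *: z j + w j) => i.
  rewrite !ffunE uz vw scaler_sumr -big_split; apply: eq_bigr => j _ /=.
  by rewrite scalerDr !scalerA mulrC.
move=> _ [c [z [c0 ->]]].
have /lspan_rangeP[d cd] : [ffun i => c i : R^o] \in lspan (range r).
  by apply: r_gen; under eq_bigr do rewrite ffunE.
exists (fun j => d j *: z) => i; rewrite ffunE.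
have -> : c i = \sum_j d j * (r j i : R).
  have /ffunP/(_ i) := cd; rewrite ffunE sum_ffunE => ->.
  by apply: eq_bigr => j _; rewrite ffunE.
by rewrite scaler_suml; apply: eq_bigr => j _; rewrite scalerA mulrC.
Qed.

End Relations.

(** Let N be the module with generators x_i and with the columns of r as
    relations. A solution w makes the sum of the x_i (x) v_i vanish in
    N (x) B, hence in N (x) A by purity; as the columns of r span all the
    relations among the x_i, its vanishing there is a solution in A. *)
Lemma pure_solve {B : lmodType R} {A : submodClosed B} (I J : finType)
    (r : I -> J -> R) (v : I -> B) (w : J -> B) :
    pure A -> (forall i, v i \in A) ->
    (forall i, v i = \sum_j r i j *: w j) ->
  exists2 w' : J -> B, (forall j, w' j \in A) &
    forall i, v i = \sum_j r i j *: w' j.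
Proof.
move=> pureA vA vw.
pose col j : {ffun I -> R^o} := [ffun i => r i j].
pose e i : {ffun I -> R^o} := [ffun k => (k == i)%:R].
pose N := quotm (lspan (range col)).
pose x i : N := to_quotm (lspan (range col)) (e i).
have sum_x (c : I -> R) :
    \sum_i c i *: x i = to_quotm (lspan (range col)) [ffun i => c i : R^o].
  transitivity (to_quotm (lspan (range col)) (\sum_i c i *: e i)).
    by rewrite linear_sum; apply: eq_bigr => i _; rewrite linearZ.
  congr to_quotm; apply/ffunP => k; rewrite sum_ffunE ffunE (bigD1 k) //=.
  rewrite !ffunE eqxx [_ *: _]mulr1 big1 ?addr0 // => i /negPf ik.
  by rewrite !ffunE eq_sym ik [_ *: _]mulr0.
have x_gen u : exists c : I -> R, u = \sum_i c i *: x i.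
  exists (quotm_repr u); rewrite sum_x -[LHS]quotm_reprK; congr to_quotm.
  by apply/ffunP => i; rewrite ffunE.
pose y : {ffun I -> subm A} := [ffun i => Sub (v i) (vA i)].
have vy i : v i = \val (y i) by rewrite ffunE SubK.
have y0 : \sum_i tens (x i) (y i) = 0.
  apply: (pureA N); rewrite linear_sum linear0.
  transitivity (\sum_i tens (x i) (v i)).
    by apply: eq_bigr => i _; rewrite vy; exact: tensor_mapE.
  transitivity (\sum_j \sum_i tens (r i j *: x i) (w j)).
    rewrite exchange_big; apply: eq_bigr => i _; rewrite vw linear_sum.
    by apply: eq_bigr => j _; rewrite linearZ tensZl.
  rewrite big1 // => j _; rewrite -tens_suml sum_x.
  have -> : to_quotm (lspan (range col)) [ffun i => r i j : R^o] = 0.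
    rewrite -(linear0 (to_quotm (lspan (range col)))); apply/to_quotm_eq.
    by rewrite subr0; apply: mem_lspan; exists j.
  exact: tens0l.
have [c|z yz] := tensor_eq0_fin x_gen (r := col) _ y0.
  rewrite sum_x -(linear0 (to_quotm (lspan (range col)))) => /to_quotm_eq.
  have -> : [ffun i => c i] = c by apply/ffunP => i; rewrite ffunE.
  by rewrite subr0.
exists (fun j => \val (z j)) => [j|i]; first exact: valP.
rewrite vy yz linear_sum; apply: eq_bigr => j _.
by rewrite linearZ ffunE.
Qed.

End TensorPurity.

(** * The completion *)

Section Completion.
Context {R : comNzRingType}.

Lemma mulmodA (V : lmodType R) (I J : {pred R}) (S : {pred V}) :
  mulmod I (mulmod J S) =i mulmod (mulmod (V := R^o) I J) S.
Proof.
move=> w; apply/idP/idP; apply: lspan_min => {w} _ [a [v [aI vS ->]]] /=.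
  move: v vS.
  apply: (@lspan_ind _ _ _
    [set v | a *: v \in mulmod (mulmod (V := R^o) I J) S]) => /=.
  - by rewrite scaler0 rpred0.
  - move=> b u v uS vS.
    by rewrite scalerDr scalerA mulrC -scalerA; apply: rpredZD.
  move=> _ [b [v [bJ vS ->]]] /=; rewrite scalerA; apply: mulmod_mem => //.
  exact: (mulmod_mem (V := R^o)).
move: a aI; apply: (@lspan_ind _ R^o _
  [set a : R^o | (a : R) *: v \in mulmod I (mulmod J S)]) => /=.
- by rewrite scale0r rpred0.
- by move=> b c d cS dS; rewrite scalerDl -scalerA; apply: rpredZD.
move=> _ [b [c [bI cJ ->]]] /=; rewrite -scalerA.
by apply: mulmod_mem => //; apply: mulmod_mem.
Qed.

Lemma mulmodC (I J : {pred R}) :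
  {subset mulmod (V := R^o) I J <= mulmod (V := R^o) J I}.
Proof.
apply: lspan_min => _ [a [b [aI bJ ->]]] /=.
rewrite [a *: b]mulrC; exact: (mulmod_mem (V := R^o)).
Qed.

Variable m : idealr R.

Lemma idealXD n k :
  {subset idealX m (n + k) <= mulmod (V := R^o) (idealX m n) (idealX m k)}.
Proof.
elim: n => [|n IHn] a.
  rewrite add0n => ak; rewrite -[a]mul1r.
  exact: (mulmod_mem (V := R^o) (S := idealX m k)).
rewrite addSn => /(mulmod_sub (V := R^o) (fun _ => id) IHn).
by rewrite mulmodA.
Qed.

Lemma adicmD (V : lmodType R) n k :
  {subset adicm m V (n + k) <= mulmod (R := R) (idealX m n) (adicm m V k)}.
Proof.
move=> v /(mulmod_sub (@idealXD n k) (fun _ => id)).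
by rewrite -mulmodA.
Qed.

Lemma adicm_le (V : lmodType R) n k : (n <= k)%N ->
  {subset adicm m V k <= adicm m V n}.
Proof.
move=> /subnK <-; elim: (k - n)%N => // j IHj v /adicm_sub; exact: IHj.
Qed.

Variable M : lmodType R.
Local Notation C := (completion m M).

(** Evaluation at n, made a function of its argument so that it can carry a
    linear structure. *)
Definition coord n (x : C) : quotm (adicm m M n) := x n.

Arguments coord n x : simpl never.

Lemma coord_linear n : linear (coord n).
Proof. by move=> a x y; rewrite /coord !completionE. Qed.

HB.instance Definition _ n :=
  GRing.isLinear.Build R C (quotm (adicm m M n)) *:%R (coord n)
    (coord_linear n).

Lemma coord_inj (x y : C) : (forall n, coord n x = coord n y) -> x = y.
Proof. exact: completionP. Qed.

Lemma to_completion_coord n v :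
  v \in adicm m M n -> coord n (to_completion m v) = 0.
Proof.
move=> vn; rewrite -(linear0 (to_quotm (adicm m M n))); apply/to_quotm_eq.
by rewrite subr0.
Qed.

Lemma adicm_coord n x : x \in adicm m C n -> coord n x = 0.
Proof.
move: x; apply: lspan_ind => [|a x y x0 y0|_ [a [x [an _ ->]]]].
- by rewrite linear0.
- by rewrite linearP /= x0 y0 scaler0 addr0.
rewrite linearZ /= -(quotm_reprK (coord n x)) -linearZ.
by apply: to_completion_coord; apply: mulmod_mem.
Qed.

Lemma completion_separated (x : C) : (forall n, x \in adicm m C n) -> x = 0.
Proof.
by move=> xC; apply: coord_inj => n; rewrite linear0; exact: adicm_coord.
Qed.

(** The sums are taken up to the level of the coordinate: the later terms
    vanish there. *)
Lemma completion_series (z : nat -> C) : (forall k, coord k (z k) = 0) ->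
  exists y : C, forall n, coord n y = coord n (\sum_(k < n) z k).
Proof.
move=> z0; pose y n := coord n (\sum_(k < n) z k).
have y_compat n : quotm_proj (adicm m M n) (y n.+1) = y n.
  rewrite [LHS](cseq_compat (\sum_(k < n.+1) z k) n) -/(coord n _).
  by rewrite big_ord_recr linearD /= z0 addr0.
by exists (Completion y_compat).
Qed.

(** With v_k in M representing x at level k, the difference x - v_n is the sum
    of the v_(n+k+1) - v_(n+k), each in m^n m^k M. Expanding the k-th difference
    on finitely many generators a_i of m^n, with coefficients w_(k,i) in m^k M,
    and summing over k first, gives x - v_n as the sum of the a_i z_i, where z_i
    is the convergent series of the w_(k,i). *)
Lemma completion_dense (x : C) n : noetherian R ->
  exists v : M, x - to_completion m v \in adicm m C n.
Proof.
move=> nR; pose v k := quotm_repr (x k).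
have v_x k : coord k (to_completion m (v k)) = coord k x by exact: quotm_reprK.
have dP k : v k.+1 - v k \in adicm m M k.
  by apply/to_quotm_eq; rewrite quotm_reprK; exact: (cseq_compat x k).
have v_le k j : v (j + k)%N - v k \in adicm m M k.
  elim: j => [|j IHj]; first by rewrite subrr rpred0.
  rewrite addSn -(subrK (v (j + k)%N) (v _)) -addrA rpredD //.
  exact: (adicm_le (leq_addl j k) (dP _)).
have [J [a a_gen]] := noetherian_regular nR (idealX m n).
have /choice[w wP] k : exists w : J -> M,
    (forall i, w i \in adicm m M k) /\
    v (n + k).+1 - v (n + k)%N = \sum_i a i *: w i.
  have [w wk dw] := mulmod_rangeP a_gen (adicmD (dP (n + k)%N)).
  by exists w.
have /choice[z zP] i : exists y : C, forall k,
    coord k y = coord k (\sum_(j < k) to_completion m (w j i)).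
  apply: (completion_series (z := fun j => to_completion m (w j i))) => k.
  by apply: to_completion_coord; have [] := wP k.
exists (v n); have -> : x - to_completion m (v n) = \sum_i (a i : R) *: z i.
  apply: coord_inj => k; rewrite linearB /= -v_x.
  have -> : coord k (to_completion m (v k)) =
            coord k (to_completion m (v (n + k)%N)).
    apply/eqP; rewrite eq_sym -subr_eq0 -!linearB.
    by apply/eqP/to_completion_coord.
  rewrite -!linearB; have -> : v (n + k)%N - v n =
      \sum_(j < k) \sum_i a i *: w j i.
    elim: k => [|k IHk]; first by rewrite addn0 subrr big_ord0.
    rewrite big_ord_recr /= -IHk -(wP k).2 addnS.
    by rewrite [RHS]addrC addrA subrK.
  rewrite exchange_big !linear_sum; apply: eq_bigr => i _ /=.
  by rewrite -scaler_sumr !linearZ /= zP linear_sum.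
apply: rpred_sum => i _; apply: mulmod_mem => //.
by rewrite a_gen; apply: mem_lspan; exists i.
Qed.

Lemma ffun_mulmod_coord (I : finType) (U : {pred {ffun I -> C}}) n u i :
  u \in mulmod (R := R) (idealX m n) U -> coord n (u i) = 0.
Proof.
move=> uU; apply: adicm_coord; move: u uU.
apply: lspan_ind => [|a u v un vn|_ [a [u [an _ ->]]]].
- by rewrite ffunE rpred0.
- by rewrite !ffunE; apply: rpredZD.
by rewrite ffunE; apply: mulmod_mem.
Qed.

(** Multiplying the hypothesis by m^n lets one write an element of m^n U as
    an element of m^(n+1) U plus f(z) with z divisible by m^n. Iterating from u,
    the series of the z converges, f of its sum agrees with u modulo m^n for
    every n, and C is separated. *)
Lemma complete_nakayama (I J : finType) (r : J -> I -> R)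
    (U : {pred {ffun I -> C}}) :
    (forall u, u \in U -> exists (u' : {ffun I -> C}) (z : J -> C),
       u' \in mulmod (R := R) m U /\
       forall i, u i = u' i + \sum_j r j i *: z j) ->
  forall u, u \in U -> exists z : J -> C, forall i, u i = \sum_j r j i *: z j.
Proof.
move=> UmU u0 u0U.
pose step n u (q : {ffun I -> C} * (J -> C)) :=
  [/\ q.1 \in mulmod (R := R) (idealX m n.+1) U, forall j, coord n (q.2 j) = 0 &
      forall i, u i = q.1 i + \sum_j r j i *: q.2 j].
have stepP n u : u \in mulmod (R := R) (idealX m n) U -> exists q, step n u q.
  move: u; apply: lspan_ind => [|a u v [[u' z] [/= u'U z0 uz]]
      [[v' w] [/= v'U w0 vw]]|_ [a [u [an uU ->]]]].
  - exists (0, fun=> 0); split=> [|j|i]; rewrite ?rpred0 ?linear0 //.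
    by rewrite !ffunE add0r big1 // => j _; rewrite scaler0.
  - exists (a *: u' + v', fun j => a *: z j + w j); split=> [|j|i] /=.
    + exact: rpredZD.
    + by rewrite linearP /= z0 w0 scaler0 addr0.
    rewrite !ffunE uz vw scalerDr addrACA scaler_sumr; congr (_ + _).
    rewrite -big_split; apply: eq_bigr => j _ /=.
    by rewrite scalerDr !scalerA mulrC.
  have [u' [z [u'U uz]]] := UmU u uU.
  exists (a *: u', fun j => a *: z j); split=> [|j|i] /=.
  - have /(mulmod_sub (@mulmodC _ _) (fun _ => id)) // :
      a *: u' \in mulmod (R := R) (mulmod (V := R^o) (idealX m n) m) U.
    by rewrite -mulmodA; apply: mulmod_mem.
  - by apply: adicm_coord; apply: mulmod_mem.
  rewrite !ffunE uz scalerDr scaler_sumr; congr (_ + _).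
  by apply: eq_bigr => j _; rewrite !scalerA mulrC.
(* F performs the n-th step on a remainder in m^n U; elsewhere its value is
   unconstrained. *)
have /choice[F FP] (p : nat * {ffun I -> C}) : exists q,
    p.2 \in mulmod (R := R) (idealX m p.1) U -> step p.1 p.2 q.
  have [/stepP[q qP]|] := boolP (p.2 \in mulmod (R := R) (idealX m p.1) U).
    by exists q.
  by move=> _; exists (0, fun=> 0).
pose u := fix u n := if n is k.+1 then (F (k, u k)).1 else u0.
pose z n := (F (n, u n)).2.
have uU n : u n \in mulmod (R := R) (idealX m n) U.
  elim: n => [|n IHn]; last by case: (FP (n, u n)).
  by rewrite -[u 0%N]scale1r; apply: mulmod_mem.
have zP n : step n (u n) (u n.+1, z n).
  by rewrite /z /= -surjective_pairing; exact: (FP (n, u n) (uU n)).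
have /choice[y yP] j : exists y : C, forall n,
    coord n y = coord n (\sum_(k < n) z k j).
  by apply: (completion_series (z := z^~ j)) => k; have [_ ->] := zP k.
exists y => i; apply: coord_inj => n.
have -> : u0 i = u n i + \sum_j r j i *: \sum_(k < n) z k j.
  elim: n => [|n ->].
    by rewrite big1 ?addr0 // => j _; rewrite big_ord0 scaler0.
  have [_ _ ->] := zP n; rewrite -addrA -big_split; congr (_ + _).
  by apply: eq_bigr => j _; rewrite big_ord_recr scalerDr addrC.
rewrite linearD /= (ffun_mulmod_coord i (uU n)) add0r !linear_sum.
by apply: eq_bigr => j _; rewrite !linearZ /= yP.
Qed.

End Completion.

(** * Modules that are pure in their completion *)

Section PureInCompletion.
Variables (R : comNzRingType) (m : idealr R) (M : lmodType R).
Hypothesis nR : noetherian R.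
Local Notation C := (completion m M).
Local Notation base := (completion_base m M).
Local Notation tc := (to_completion m).

Lemma completion_baseP x : reflect (exists v : M, x = tc v) (x \in base).
Proof.
apply: (iffP (asboolP _)) => [[v _ ->]|[v ->]]; first by exists v.
by exists v.
Qed.

(** The form of density used with [pure_solve]: the w_k become the unknowns,
    and replacing them by other elements of C does not leave m^n C. *)
Lemma completion_dense_sum (x : C) n : exists (v : M) (K : finType)
    (c : K -> R) (w : K -> C), x - tc v = \sum_k c k *: w k /\
  forall w' : K -> C, \sum_k c k *: w' k \in adicm m C n.
Proof.
have [v xv] := completion_dense x n nR.
have [K [c c_gen]] := noetherian_regular nR (idealX m n).
have [w _ xvw] := mulmod_rangeP c_gen xv.
exists v, K, c, w; split=> // w'; apply: rpred_sum => k _.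
by apply: mulmod_mem => //; rewrite c_gen; apply: mem_lspan; exists k.
Qed.

(** In C / X the class of v equals - sum_k c_k w_k, so [pure_solve] replaces
    the w_k by classes of elements b_k of M. Then v + sum_k c_k b_k lies in X
    and in M, hence is zero, which puts v, and so x, in m^n C. *)
Lemma completion_pure_essential : pure base -> pure_essential base.
Proof.
move=> pureM; split=> // X XM0 pureX x xX; apply: completion_separated => n.
have [v [K [c [w [xvw cn]]]]] := completion_dense_sum x n.
pose q : {linear C -> quotm X} := to_quotm X.
have q0 y : y \in X -> q y = 0.
  by move=> yX; rewrite -(linear0 q); apply/to_quotm_eq; rewrite subr0.
have imq y : y \in imagem q (addm X base) -> exists2 b, b \in base & y = q b.
  move=> /asboolP[z zXM ->]; move: z zXM.
  apply: (@lspan_ind _ _ _ [set z | exists2 b, b \in base & q z = q b]).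
  - by exists 0; rewrite ?rpred0.
  - move=> a y1 y2 [b bM qy] [d dM qz] /=.
    exists (a *: b + d); first exact: rpredZD.
    by rewrite !linearP qy qz.
  move=> z [zX|zM]; last by exists z.
  by exists 0; rewrite ?rpred0 // linear0 q0.
have vM : tc v \in base by apply/completion_baseP; exists v.
have [_||w' w'M vw'] := pure_solve (I := unit) (v := fun=> q (tc v))
    (r := fun _ k => - c k) (w := fun k => q (w k)) pureX.
- by apply/asboolP; exists (tc v) => //; apply: mem_lspan; right.
- move=> _; have -> : tc v = x - \sum_k c k *: w k by rewrite -xvw subKr.
  rewrite linearB /= q0 // sub0r linear_sum -sumrN.
  by apply: eq_bigr => k _; rewrite linearZ scaleNr.
have /choice[b bP] k : exists b, b \in base /\ w' k = q b.
  by have [b bM w'b] := imq _ (w'M k); exists b.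
have v_sum : tc v = - \sum_k c k *: b k.
  apply/eqP; rewrite -subr_eq0; apply/eqP/XM0.
    apply/to_quotm_eq; rewrite -!/(q _) (vw' tt) linearN linear_sum -sumrN.
    by apply: eq_bigr => k _; rewrite linearZ scaleNr (bP k).2.
  rewrite opprK rpredD //; apply: rpred_sum => k _.
  by rewrite rpredZ //; case: (bP k).
by rewrite -(subrK (tc v) x) xvw v_sum; apply: submB.
Qed.

(** The witness is the submodule of M killed by p. An approximation v0 of x
    satisfies g_j v0 = - sum_k g_j c_k w_k for generators g_j of p, because
    g_j x = 0; solving this system in M corrects v0, within the same precision, to an
    element killed by p. *)
Lemma completion_Ass_Koatt : injective (tc : M -> C) -> pure base ->
  Ass C `<=` Koatt M.
Proof.
move=> tc_inj pureM p [x px].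
have [J [g g_gen]] := noetherian_regular nR (lspan (V := R^o) [set` p]).
have ann_gen (V : lmodType R) (y : V) : (forall j, (g j : R) *: y = 0) ->
    forall a, a \in p -> a *: y = 0.
  move=> gy a ap.
  have : (a : R^o) \in lspan (V := R^o) [set` p] by apply: mem_lspan.
  by rewrite g_gen; apply: lspan_annihilates => _ [j _ <-].
have gx j : (g j : R) *: x = 0.
  have : g j \in lspan (V := R^o) [set` p].
    by rewrite g_gen; apply: mem_lspan; exists j.
  apply: lspan_annihilates => a.
  by rewrite px; apply.
pose U : submodClosed M := lspan [set v | forall a, a \in p -> a *: v = 0].
exists U.
apply/predeqP => a; split=> [ap|aU].
  move=> v /=; apply: (@lspan_ind _ _ _ [set v | a *: v = 0]) => /=.
  - by rewrite scaler0.
  - move=> b u w ua wa.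
    by rewrite scalerDr scalerA mulrC -scalerA ua wa scaler0 addr0.
  by move=> u; apply.
rewrite px => _ ->; apply: completion_separated => n.
have [v0 [K [c [w [xvw cn]]]]] := completion_dense_sum x n.
have [j|j|w' w'M vw'] := pure_solve (v := fun j => tc ((g j : R) *: v0))
    (r := fun j k => - ((g j : R) * c k)) (w := w) pureM.
- by apply/completion_baseP; eexists.
- have -> : tc ((g j : R) *: v0) = (g j : R) *: (x - \sum_k c k *: w k).
    by rewrite -xvw subKr linearZ.
  rewrite scalerBr gx sub0r scaler_sumr -sumrN; apply: eq_bigr => k _.
  by rewrite scalerA scaleNr.
have /choice[b bP] k : exists b, w' k = tc b by exact/completion_baseP.
pose v := v0 + \sum_k c k *: b k.
have av : a *: v = 0.
  apply: aU; apply: mem_lspan; apply: ann_gen => j; apply: tc_inj.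
  rewrite scalerDr linearD /= vw' linear0 scaler_sumr linear_sum -big_split.
  rewrite big1 // => k _ /=.
  by rewrite scalerA linearZ bP scaleNr addNr.
have -> : a *: x = a *: (x - tc v).
  by rewrite scalerBr -linearZ av linear0 subr0.
rewrite rpredZ // /v linearD opprD addrA xvw linear_sum -sumrB.
rewrite (eq_bigr (fun k => c k *: (w k - tc (b k)))) // => k _.
by rewrite scalerBr linearZ.
Qed.

(** U consists of the families y in M^I, seen in C^I, whose sum of x_i (x) y_i
    lies in the radical-full part D. From D = m D and the finite generation of
    the relations among the x_i one gets U = m U + f(M^J), f being the matrix
    of the relations. *)
Lemma completion_totally_reduced : injective (tc : M -> C) -> pure base ->
  totally_reduced m M.
Proof.
move=> tc_inj pureM X [s s_gen] t tD.
pose D := radical_part m (tensor X M).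
pose x := tnth (in_tuple s).
have x_gen u : exists c : 'I_(size s) -> R, u = \sum_i c i *: x i.
  by have := s_gen u; rewrite lspan_seq_range => /lspan_rangeP.
have [J [r r_gen]] := noetherian_power (n := size s) nR
  (lspan [set c : {ffun 'I_(size s) -> R^o} | \sum_i (c i : R) *: x i = 0]).
have r_rel j : \sum_i (r j i : R) *: x i = 0.
  have : r j \in lspan (range r) by apply: mem_lspan; exists j.
  rewrite -r_gen.
  apply: (@lspan_ind _ _ _
    [set c : {ffun 'I_(size s) -> R^o} | \sum_i (c i : R) *: x i = 0]) => //=.
    by rewrite big1 // => i _; rewrite ffunE scale0r.
  move=> a c d c0 d0; under eq_bigr do rewrite !ffunE scalerDl -scalerA.
  by rewrite big_split -scaler_sumr c0 d0 /= scaler0 addr0.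
have r_all (c : {ffun 'I_(size s) -> R^o}) : \sum_i (c i : R) *: x i = 0 ->
    c \in lspan (range r).
  by move=> c0; rewrite -r_gen; apply: mem_lspan.
pose hat (y : 'I_(size s) -> M) : {ffun 'I_(size s) -> C} :=
  [ffun i => tc (y i)].
pose U : {pred {ffun 'I_(size s) -> C}} := fun u =>
  `[< exists2 y, \sum_i tens (x i) (y i) \in D & u = hat y >].
have mD t' : t' \in mulmod (R := R) m D -> exists2 y,
    hat y \in mulmod (R := R) m U & t' = \sum_i tens (x i) (y i).
  move: t'; apply: lspan_ind => [|a _ _ [y yU ->] [z zU ->]|].
  - exists (fun=> 0); last by rewrite big1 // => i _; rewrite linear0.
    have -> : hat (fun=> 0) = 0 by apply/ffunP => i; rewrite !ffunE linear0.
    exact: rpred0.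
  - exists (fun i => a *: y i + z i).
      have -> : hat (fun i => a *: y i + z i) = a *: hat y + hat z.
        by apply/ffunP => i; rewrite !ffunE linearP.
      exact: rpredZD.
    rewrite scaler_sumr -big_split; apply: eq_bigr => i _ /=.
    by rewrite linearP.
  move=> _ [a [d [am dD ->]]]; have [y dy] := tensor_sum x_gen d.
  exists (fun i => a *: y i).
    have -> : hat (fun i => a *: y i) = a *: hat y.
      by apply/ffunP => i; rewrite !ffunE linearZ.
    by apply: mulmod_mem => //; apply/asboolP; exists y; rewrite -?dy.
  by rewrite dy scaler_sumr; apply: eq_bigr => i _; rewrite linearZ.
have [y ty] := tensor_sum x_gen t.
have yU : hat y \in U by apply/asboolP; exists y; rewrite -?ty.
have [u|z yz] := complete_nakayama (r := fun j i => r j i : R) _ yU.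
  move=> /asboolP[y1 y1D ->]; move: (y1D).
  rewrite -[_ \in D]radical_full_part => /mD[y2 y2U].
  move=> /eqP; rewrite -subr_eq0 -sumrB => /eqP y12.
  have [|z zP] := tensor_eq0_fin x_gen (Y := M) (y := [ffun i => y1 i - y2 i])
    r_all.
    by rewrite -[RHS]y12; apply: eq_bigr => i _; rewrite ffunE linearB.
  exists (hat y2), (fun j => tc (z j)); split=> // i.
  have := zP i; rewrite !ffunE => /eqP; rewrite subr_eq addrC => /eqP ->.
  rewrite linearD linear_sum; congr (_ + _); apply: eq_bigr => j _.
  by rewrite linearZ.
have [i|i|w wM yw] := pure_solve (v := hat y)
    (r := fun i j => r j i : R) (w := z) pureM.
- by apply/completion_baseP; exists (y i); rewrite ffunE.
- exact: yz.
have /choice[b bP] j : exists b, w j = tc b by exact/completion_baseP.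
have yb i : y i = \sum_j (r j i : R) *: b j.
  apply: tc_inj; have := yw i; rewrite ffunE => ->.
  by rewrite linear_sum; apply: eq_bigr => j _; rewrite linearZ bP.
rewrite ty; transitivity (\sum_j tens (\sum_i (r j i : R) *: x i) (b j)).
  under [RHS]eq_bigr do rewrite tens_suml.
  rewrite exchange_big; apply: eq_bigr => i _ /=.
  by rewrite yb linear_sum; apply: eq_bigr => j _; rewrite linearZ tensZl.
by rewrite big1 // => j _; rewrite r_rel tens0l.
Qed.

End PureInCompletion.

Theorem mainTheorem4 (R : comNzRingType) (m : idealr R) (M : lmodType R)
    (R_noetherian : noetherian R) (R_local : local_ring m)
    (M_separated : separated m M) (M_pure : pure (completion_base m M)) :
  [/\ pure_essential (completion_base m M),
      totally_reduced m M
    & (Ass (completion m M) `<=` Koatt M)%classic].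
Proof.
have tc_inj := to_completion_inj M_separated.
split.
- exact: completion_pure_essential.
- exact: completion_totally_reduced.
- exact: completion_Ass_Koatt.
Qed.
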